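(* Let $d(k)$ denote the number of positive divisors of the positive integer $k$ and let $\gamma$ be Euler's constant. For all real $q\in(0,1)$, $$\gamma-1+\frac{(1-q)\log(1-q)}{q\log(q)}<\sum_{k=1}^\infty\bigl(d(k+1)-d(k)\bigr)q^k<\frac{(1-q)\log(1-q)}{q\log(q)}.$$ Moreover the constants are best possible: if $\alpha_0,\beta_0$ are real constants such that $\alpha_0+\frac{(1-q)\log(1-q)}{q\log(q)}<\sum_{k=1}^\infty(d(k+1)-d(k))q^k<\beta_0+\frac{(1-q)\log(1-q)}{q\log(q)}$ for all $q\in(0,1)$, then $\alpha_0\le\gamma-1$ and $\beta_0\ge0$.
   Context: $\log$ denotes the natural logarithm. *)

(* Defs.v *)
From mathcomp Require Import all_boot all_order all_algebra.
From mathcomp Require Import all_classical all_reals all_analysis.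
Set Implicit Arguments.
Unset Strict Implicit.
Unset Printing Implicit Defensive.
Import Order.TTheory GRing.Theory Num.Theory.
Import numFieldNormedType.Exports.
Local Open Scope classical_set_scope.
Local Open Scope ring_scope.

Definition num_divisors (k : nat) : nat := size (divisors k).

(* [series harmonic n] is 1 + 1/2 + ... + 1/n. *)
Definition euler_gamma (R : realType) : R :=
  limn (fun n : nat => series harmonic n - ln n%:R : R).

Definition divisor_diff_psum (R : realType) (q : R) (n : nat) : R :=
  \sum_(1 <= k < n) ((num_divisors k.+1)%:R - (num_divisors k)%:R) * q ^+ k.

(* Meaningful only where the partial sums converge. *)
Definition divisor_diff_sum (R : realType) (q : R) : R :=
  limn (divisor_diff_psum q).

Definition log_quotient (R : realType) (q : R) : R :=
  ((1 - q) * ln (1 - q)) / (q * ln q).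

(* Main.v *)
(* Put x = - ln q and f(t) = q^t / (1 - q^t). Exchanging sums in
   sum d(k) q^k = sum f(n) (Lambert) and integrating f over [1, oo) give
     sum (d(k+1) - d(k)) q^k - log_quotient q = E / f(1) - 1,
   where E = sum_(n >= 1) f(n) - int_1^oo f.
   Upper bound: f decreases, so the partial sums up to N minus int_1^N f
   decrease from f(1) to E.
   Lower bound: t f(t) is convex, hence below its chord on [n, n+1]. Dividing
   the chord by t, integrating and summing by parts bound E below by
   sum w_n (u_n - u_(n-1)) with w_n = n f(n) and
   u_N = H_N - int_N^(N+1) ln, u_0 = 0. Since u decreases strictly from N = 1 on
   to gamma, w_n <= w_1 = f(1) and w_2 < w_1, the sum exceeds f(1) gamma.
   Sharpness: E / f(1) <= H_N - ln N + N x for all N, used at x = N^-2, and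
   E / f(1) >= 1 - 1 / x, used as x tends to +oo. *)
Require Import Defs.
From mathcomp Require Import all_boot all_order all_algebra.
From mathcomp Require Import all_classical all_reals all_analysis.
From mathcomp Require Import ring lra.
Import Order.TTheory GRing.Theory Num.Theory.
Import numFieldNormedType.Exports.
Local Open Scope classical_set_scope.
Local Open Scope ring_scope.
Set Implicit Arguments.
Unset Strict Implicit.
Unset Printing Implicit Defensive.

(** * Differentiation rules and consequences of the mean value theorem *)

Section pointwise_derivatives.
Variables (R : realType) (f g : R -> R) (x a b : R).
Hypotheses (fa : is_derive x 1 f a) (gb : is_derive x 1 g b).

(** Derivatives of compound expressions are assembled below as proof terms; this lemma replaces the
    raw derivative by the intended closed form. *)
Lemma deriv_eq c : a = c -> is_derive x 1 f c.
Proof. by move=> <-. Qed.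

Lemma derivD : is_derive x 1 (fun y => f y + g y) (a + b).
Proof. exact: is_deriveD. Qed.

Lemma derivB : is_derive x 1 (fun y => f y - g y) (a - b).
Proof. exact: is_deriveB. Qed.

Lemma derivN : is_derive x 1 (fun y => - f y) (- a).
Proof. exact: is_deriveN. Qed.

Lemma derivM : is_derive x 1 (fun y => f y * g y) (f x * b + g x * a).
Proof. exact: is_deriveM. Qed.

Lemma derivZ (k : R) : is_derive x 1 (fun y => k * f y) (k * a).
Proof. exact: is_deriveZ. Qed.

Lemma derivX n : is_derive x 1 (fun y => f y ^+ n) (n%:R * f x ^+ n.-1 * a).
Proof.
have := is_deriveX n fa.
by congr (is_derive _ _ _ _); apply/funext => y; rewrite exprfctE.
Qed.

Lemma derivV : f x != 0 -> is_derive x 1 (fun y => (f y)^-1) (- f x ^- 2 * a).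
Proof. by move=> fx0; exact: is_deriveV. Qed.

Lemma deriv_ln : 0 < f x -> is_derive x 1 (fun y => ln (f y)) ((f x)^-1 * a).
Proof. by move=> fx0; exact: is_derive1_comp (is_derive1_ln fx0) fa. Qed.

Lemma deriv_exp : is_derive x 1 (fun y => expR (f y)) (expR (f x) * a).
Proof. exact: is_derive1_comp (is_derive_expR (f x)) fa. Qed.

Lemma deriv_idfun : is_derive x 1 (fun y : R => y) 1.
Proof. exact: is_derive_id. Qed.

Lemma deriv_cst (k : R) : is_derive x 1 (fun=> k : R) 0.
Proof. exact: is_derive_cst. Qed.

End pointwise_derivatives.

Lemma mvt_open (R : realType) (f df : R -> R) (a b : R) : a < b ->
  (forall x, a <= x <= b -> is_derive x 1 f (df x)) ->
  exists2 c, a < c < b & f b - f a = df c * (b - a).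
Proof.
move=> ab dfE.
have [||c cab fab] := @MVT R f df a b ab.
- move=> x; rewrite in_itv /= => /andP[ax xb].
  by apply: dfE; rewrite !ltW.
- apply: derivable_within_continuous => x; rewrite in_itv /= => xab.
  by have [] := dfE x xab.
- by exists c => //; move: cab; rewrite in_itv.
Qed.

Lemma derive_gt0_lt (R : realType) (f df : R -> R) (a b : R) : a < b ->
  (forall x, a <= x <= b -> is_derive x 1 f (df x)) ->
  (forall x, a < x < b -> 0 < df x) -> f a < f b.
Proof.
move=> ab dfE df0; have [c cab fab] := mvt_open ab dfE.
by rewrite -subr_gt0 fab mulr_gt0 ?df0 // subr_gt0.
Qed.

Lemma derive_ge0_le (R : realType) (f df : R -> R) (a b : R) : a <= b ->
  (forall x, a <= x <= b -> is_derive x 1 f (df x)) ->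
  (forall x, a < x < b -> 0 <= df x) -> f a <= f b.
Proof.
rewrite le_eqVlt => /predU1P[->//|ab] dfE df0.
have [c cab fab] := mvt_open ab dfE.
by rewrite -subr_ge0 fab mulr_ge0 ?df0 // subr_ge0 ltW.
Qed.

(** The mean value theorem on each side of [y] gives slopes [df c] and [df d] with [c < y < d];
    comparing these slopes is the chord inequality. *)
Lemma le_chord (R : realType) (f df : R -> R) (a b y : R) : a < y < b ->
  (forall x, a <= x <= b -> is_derive x 1 f (df x)) ->
  (forall x z, a <= x -> x <= z -> z <= b -> df x <= df z) ->
  (b - a) * f y <= (b - y) * f a + (y - a) * f b.
Proof.
move=> /andP[ay yb] dfE dfm.
have [x xab|c /andP[ac cy] fc] := mvt_open (f := f) (df := df) ay.
  by apply: dfE; move/andP: xab => [-> /le_trans->] //; rewrite ltW.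
have [x xab|d /andP[yd db] fd] := mvt_open (f := f) (df := df) yb.
  by apply: dfE; move/andP: xab => [/(le_trans (ltW ay))-> ->].
have cd : df c <= df d by apply: dfm; lra.
suff : (f y - f a) * (b - y) <= (f b - f y) * (y - a) by nra.
rewrite fc fd -!mulrA [(b - y) * _]mulrC ler_wpM2r //.
by rewrite mulr_ge0 // subr_ge0 ltW.
Qed.

(** * Convexity of y / (exp y - 1) and the resulting chord bound *)

(* The generating function of the Bernoulli numbers; at [y = 0] division gives
   [0] instead of the limit [1]. *)
Definition bernoulli_gf (R : realType) (y : R) : R := y / (expR y - 1).

Definition bernoulli_gf' (R : realType) (y : R) : R :=
  (expR y - 1 - y * expR y) / (expR y - 1) ^+ 2.

Lemma is_derive_bernoulli_gf (R : realType) (y : R) : 0 < y ->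
  is_derive y 1 (@bernoulli_gf R) (bernoulli_gf' y).
Proof.
move=> y0; have E0 : expR y - 1 != 0 :> R by rewrite subr_eq0 gt_eqF ?expR_gt1.
have dE : is_derive y (1 : R) (fun z : R => expR z - 1) (expR y).
  by apply: is_derive_eq; rewrite subr0.
refine (deriv_eq (derivM (deriv_idfun y) (derivV dE E0)) _).
rewrite /bernoulli_gf' /=; field; exact: E0.
Qed.

(** This is the sign-deciding factor of the second derivative of [bernoulli_gf]. It vanishes at [0],
    and its derivative is nonnegative because [1 - x <= expR (- x)]. *)
Lemma expR_second_order (R : realType) (y : R) : 0 <= y ->
  0 <= (y - 2) * expR y + y + 2.
Proof.
move=> y0.
have dE (x : R) : 0 <= x <= y -> is_derive x (1 : R)
   (fun z : R => (z - 2) * expR z + z + 2) ((x - 1) * expR x + 1).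
  move=> _; refine (deriv_eq (derivD (derivD (derivM (derivB (deriv_idfun x)
      (deriv_cst x 2)) (deriv_exp (deriv_idfun x))) (deriv_idfun x))
      (deriv_cst x 2)) _).
  by rewrite /= /cst; ring.
have dge0 (x : R) : 0 < x < y -> 0 <= (x - 1) * expR x + 1.
  move=> _; have := expR_ge1Dx (- x); rewrite expRN => xE.
  have E0 := expR_gt0 x.
  suff : (1 - x) * expR x <= (expR x)^-1 * expR x.
    by rewrite mulVf ?gt_eqF //; lra.
  by rewrite ler_wpM2r // ltW.
by have := derive_ge0_le y0 dE dge0; rewrite expR0; lra.
Qed.

Lemma bernoulli_gf'_nondecreasing (R : realType) (x y : R) :
  0 < x -> x <= y -> bernoulli_gf' x <= bernoulli_gf' y.
Proof.
move=> x0 xy.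
have dE (z : R) : x <= z <= y -> is_derive z (1 : R) (@bernoulli_gf' R)
   (expR z * ((z - 2) * expR z + z + 2) / (expR z - 1) ^+ 3).
  move=> /andP[xz _]; have z0 := lt_le_trans x0 xz.
  have E0 : expR z - 1 != 0 :> R by rewrite subr_eq0 gt_eqF ?expR_gt1.
  have dE : is_derive z (1 : R) (fun z : R => expR z - 1) (expR z).
    by apply: is_derive_eq; rewrite subr0.
  have E20 : (expR z - 1) ^+ 2 != 0 :> R by rewrite expf_eq0 (negbTE E0) andbF.
  refine (deriv_eq (derivM (derivB dE (derivM (deriv_idfun z)
      (deriv_exp (deriv_idfun z)))) (derivV (derivX dE 2) E20)) _).
  rewrite /=; field; exact: E0.
apply: (derive_ge0_le xy dE) => z /andP[xz _].
have z0 := lt_trans x0 xz.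
by rewrite divr_ge0 ?exprn_ge0 ?subr_ge0 ?mulr_ge0 ?expR_ge0 ?expR_second_order
  ?ltW // expR_gt1.
Qed.

(* [ln (1 - expR (- y))] is a primitive of [bernoulli_gf y / y], which lies
   below [A / y + B] where [A + B * y] is the chord of the convex function
   [bernoulli_gf] over [a, b]. *)
Lemma ln1BexpRN_diff_le (R : realType) (a b : R) (p := @bernoulli_gf R)
    (B := (p b - p a) / (b - a)) : 0 < a -> a < b ->
  ln (1 - expR (- b)) - ln (1 - expR (- a)) <=
    (p a - B * a) * (ln b - ln a) + (p b - p a).
Proof.
move=> a0 ab; set A := p a - B * a.
have ba : b - a != 0 by rewrite subr_eq0 gt_eqF.
have dE (z : R) : a <= z <= b -> is_derive z (1 : R)
   (fun y : R => A * ln y + B * y - ln (1 - expR (- y)))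
   ((A + B * z - p z) / z).
  move=> /andP[az _]; have z0 := lt_le_trans a0 az.
  have E0 : expR z - 1 != 0 :> R by rewrite subr_eq0 gt_eqF ?expR_gt1.
  have E1 : 0 < 1 - expR (- z) :> R by rewrite subr_gt0 expR_lt1 oppr_lt0.
  have dE : is_derive z (1 : R) (fun z : R => 1 - expR (- z)) (expR (- z)).
    refine (deriv_eq (derivB (deriv_cst z 1)
        (deriv_exp (derivN (deriv_idfun z)))) _).
    by rewrite /=; ring.
  refine (deriv_eq (derivB (derivD (derivZ (deriv_ln (deriv_idfun z) z0) A)
     (derivZ (deriv_idfun z) B)) (deriv_ln dE E1)) _).
  rewrite /= /p /bernoulli_gf expRN.
  have ez : expR z != 0 :> R by rewrite gt_eqF ?expR_gt0.
  by field; rewrite ez E0 gt_eqF.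
have K : forall z, a < z < b -> 0 <= (A + B * z - p z) / z.
  move=> z azb; have /andP[az zb] := azb; have z0 := lt_trans a0 az.
  apply: divr_ge0; last exact: ltW.
  have cv : (b - a) * p z <= (b - z) * p a + (z - a) * p b.
    apply: (@le_chord R p (@bernoulli_gf' R) a b z) => //
      [x /andP[ax _]|x y ax xy _].
      by apply: is_derive_bernoulli_gf; lra.
    by apply: bernoulli_gf'_nondecreasing => //; lra.
  have -> : A + B * z - p z =
     ((b - z) * p a + (z - a) * p b - (b - a) * p z) / (b - a).
    by rewrite /A /B; field.
  by rewrite divr_ge0 ?subr_ge0 // ltW.
have := derive_ge0_le (ltW ab) dE K.
have -> : p b - p a = B * (b - a) by rewrite /B divfK.
lra.
Qed.

(** * Logarithmic inequalities and sequences tending to Euler's constant *)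

Lemma entropy_gt (R : realType) (z : R) : 0 < z -> z < 1 ->
  z ^+ 2 < (1 + z) * ln (1 + z) + (1 - z) * ln (1 - z).
Proof.
move=> z0 z1.
have dp (x : R) : 0 <= x <= z -> is_derive x (1 : R) (fun y : R => 1 + y) 1.
  move=> _; refine (deriv_eq (derivD (deriv_cst x 1) (deriv_idfun x)) _).
  by rewrite add0r.
have dm (x : R) : 0 <= x <= z -> is_derive x (1 : R) (fun y : R => 1 - y) (-1).
  move=> _; refine (deriv_eq (derivB (deriv_cst x 1) (deriv_idfun x)) _).
  by rewrite add0r.
have dlp (x : R) : 0 <= x <= z ->
    is_derive x (1 : R) (fun y : R => ln (1 + y)) (1 + x)^-1.
  move=> xz; have x0 : 0 < 1 + x by lra.
  refine (deriv_eq (deriv_ln (dp x xz) x0) _).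
  by rewrite mulr1.
have dlm (x : R) : 0 <= x <= z ->
    is_derive x (1 : R) (fun y : R => ln (1 - y)) (- (1 - x)^-1).
  move=> xz; have x0 : 0 < 1 - x by lra.
  refine (deriv_eq (deriv_ln (dm x xz) x0) _).
  by rewrite mulrN1.
(* This expression is the derivative of the difference of the two sides. Both it and the difference
   vanish at [0], and its own derivative is 2 y^2 / (1 - y^2). *)
have k0 (x : R) : 0 < x < z -> 0 < ln (1 + x) - ln (1 - x) - 2 * x.
  move=> /andP[x0 xz].
  have dk (y : R) : 0 <= y <= x -> is_derive y (1 : R)
     (fun y : R => ln (1 + y) - ln (1 - y) - 2 * y)
     ((1 + y)^-1 + (1 - y)^-1 - 2).
    move=> yx; have yz : 0 <= y <= z by lra.
    refine (deriv_eq ((derivB (derivB (dlp y yz)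
      (dlm y yz)) (derivZ (deriv_idfun y) 2))) _).
    by rewrite /=; ring.
  have := derive_gt0_lt x0 dk; rewrite addr0 !subr0 ln1 mulr0 !subr0; apply.
  move=> y /andP[y0 yx].
  have -> : (1 + y)^-1 + (1 - y)^-1 - 2 = 2 * y ^+ 2 / ((1 + y) * (1 - y)).
    by field; lra.
  by rewrite divr_gt0 ?mulr_gt0 ?exprn_gt0 //; lra.
have dh (x : R) : 0 <= x <= z -> is_derive x (1 : R)
   (fun y : R => (1 + y) * ln (1 + y) + (1 - y) * ln (1 - y) - y ^+ 2)
   (ln (1 + x) - ln (1 - x) - 2 * x).
  move=> xz; refine (deriv_eq (derivB (derivD (derivM (dp x xz) (dlp x xz))
     (derivM (dm x xz) (dlm x xz))) (derivX (deriv_idfun x) 2)) _).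
  by rewrite /=; field; lra.
have := derive_gt0_lt z0 dh k0.
by rewrite addr0 !subr0 ln1 mulr0 expr0n /= addr0 subr0 subr_gt0.
Qed.

Lemma ln_ltB1 (R : realType) (y : R) : 0 < y -> y != 1 -> ln y < y - 1.
Proof.
move=> y0 y1; have := @expR_gt1Dx R (ln y).
by rewrite ln_eq0 // lnK ?posrE // => /(_ y1); lra.
Qed.

Lemma ln_leB1 (R : realType) (y : R) : 0 < y -> ln y <= y - 1.
Proof.
by move=> y0; have := @expR_ge1Dx R (ln y); rewrite lnK ?posrE //; lra.
Qed.

(** The integral of 1/t over [N, N+1] with N = [n.+1]. *)
Definition ln_step (R : realType) (n : nat) : R := ln n.+2%:R - ln n.+1%:R.

Lemma ln_step_ge (R : realType) n : n.+2%:R^-1 <= ln_step R n.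
Proof.
have h1 : 0 < n.+1%:R :> R by [].
have h2 : 0 < n.+2%:R :> R by [].
have := ln_leB1 (divr_gt0 h1 h2); rewrite ln_div ?posrE // /ln_step.
have -> : n.+1%:R / n.+2%:R - 1 = - n.+2%:R^-1 :> R.
  by rewrite -[n.+2%:R]natr1; field; lra.
by rewrite lerNr opprB.
Qed.

Lemma ln_step_le (R : realType) n : ln_step R n <= n.+1%:R^-1.
Proof.
have h1 : 0 < n.+1%:R :> R by [].
have h2 : 0 < n.+2%:R :> R by [].
have := ln_leB1 (divr_gt0 h2 h1); rewrite ln_div ?posrE // /ln_step.
have -> : n.+2%:R / n.+1%:R - 1 = n.+1%:R^-1 :> R; last by [].
by rewrite -[n.+2%:R]natr1; field; lra.
Qed.

Lemma series_harmonicS (R : realType) n :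
  series harmonic n.+1 = series harmonic n + n.+1%:R^-1 :> R.
Proof. by rewrite !seriesEnat /= big_nat_recr. Qed.

Lemma cvg_euler_gamma (R : realType) :
  (fun n => series harmonic n - ln n%:R : R) @ \oo --> euler_gamma R.
Proof.
pose v n : R := series harmonic n - ln n%:R.
(* The shift drops index [0], where the logarithm has only a default value. From N = 1 on the
   sequence decreases, and H_N >= ln (N+1) bounds it below. *)
have : cvgn (fun n => v n.+1).
  apply: nonincreasing_is_cvgn.
    apply/nonincreasing_seqP => n; rewrite /v series_harmonicS.
    by have := ln_step_ge R n; rewrite /ln_step; move: n.+2%:R^-1 => i; lra.
  exists 0 => _ [n _ <-]; rewrite /v.
  suff : ln n.+2%:R <= series harmonic n.+1 :> R.
    have : 0 < n.+2%:R^-1 :> R by [].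
    by have := ln_step_ge R n; rewrite /ln_step; move: n.+2%:R^-1 => i; lra.
  elim: n => [|n IH]; rewrite series_harmonicS.
    by rewrite seriesEnat /= big_geq // add0r -[ln _]subr0
      -[X in _ - X](@ln1 R);
      exact: ln_step_le.
  by have := ln_step_le R n.+1; rewrite /ln_step; move: n.+2%:R^-1 => i; lra.
by move=> vl; have := vl; rewrite (cvg_shiftS v) => /cvgP.
Qed.

(* [trapezoidal_gamma R n] is [H_N - \int_N^(N+1) ln] with [N = n.+1]. *)
Definition trapezoidal_gamma (R : realType) (n : nat) : R :=
  series harmonic n.+1 - n.+1%:R * ln_step R n - ln n.+2%:R + 1.

Lemma trapezoidal_gammaS (R : realType) n :
  trapezoidal_gamma R n.+1 = trapezoidal_gamma R n + n.+2%:R^-1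
    - n.+3%:R * ln_step R n.+1 + n.+1%:R * ln_step R n.
Proof.
rewrite /trapezoidal_gamma series_harmonicS /ln_step.
by rewrite -[n.+3%:R]natr1 -[n.+2%:R]natr1; ring.
Qed.

(** Multiplied by [n.+2], [entropy_gt] at z = 1 / [n.+2] says exactly that the increment in
    [trapezoidal_gammaS] is negative. *)
Lemma trapezoidal_gamma_decr (R : realType) n :
  trapezoidal_gamma R n.+1 < trapezoidal_gamma R n.
Proof.
rewrite trapezoidal_gammaS /ln_step.
have n2 : 0 < n.+2%:R :> R by [].
have z1 : n.+2%:R^-1 < 1 :> R by rewrite invf_lt1 // ltr1n.
have := entropy_gt _ z1; rewrite invr_gt0 n2 => /(_ isT).
have -> : 1 + n.+2%:R^-1 = n.+3%:R / n.+2%:R :> R.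
  by rewrite -[n.+3%:R]natr1; field; lra.
have -> : 1 - n.+2%:R^-1 = n.+1%:R / n.+2%:R :> R.
  by rewrite -[n.+2%:R]natr1; field; lra.
rewrite !ln_div ?posrE //.
set a := ln _; set b := ln n.+2%:R; set c := ln _ => H.
have : n.+2%:R * (n.+2%:R^-1 ^+ 2) < n.+2%:R * (n.+3%:R / n.+2%:R * (a - b) +
  n.+1%:R / n.+2%:R * (c - b)) by rewrite ltr_pM2l.
have -> : n.+2%:R * (n.+2%:R^-1 ^+ 2) = n.+2%:R^-1 :> R.
  by field; lra.
have -> : n.+2%:R * (n.+3%:R / n.+2%:R * (a - b) +
  n.+1%:R / n.+2%:R * (c - b)) = n.+3%:R * (a - b) + n.+1%:R * (c - b).
  by field; lra.
move: n.+2%:R^-1 => i; lra.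
Qed.

(** With N = [n.+1] the term is H_N - ln N + 1 - (N+1) [ln_step R n], and the last product lies
    between 1 and 1 + 1/N. *)
Lemma cvg_trapezoidal_gamma (R : realType) :
  trapezoidal_gamma R @ \oo --> euler_gamma R.
Proof.
have v : (fun n => series harmonic n.+1 - ln n.+1%:R : R) @ \oo
    --> euler_gamma R.
  by have := @cvg_euler_gamma R; rewrite -(cvg_shiftS _).
have v' : (fun n => series harmonic n.+1 - ln n.+1%:R - harmonic n : R) @ \oo
    --> euler_gamma R.
  by rewrite -[euler_gamma R]subr0; exact: cvgB v cvg_harmonic.
apply: (squeeze_cvgr _ v' v); near=> n => /=.
have s1 : 1 <= (n.+1%:R + 1) * ln_step R n.
  by rewrite natr1 mulrC -ler_pdivrMr // mul1r ln_step_ge.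
have s2 : n.+1%:R * ln_step R n <= 1.
  by rewrite mulrC -ler_pdivlMr // mul1r ln_step_le.
have := ln_step_le R n; rewrite /trapezoidal_gamma.
move: n.+1%:R^-1 s1 s2 => i; rewrite /ln_step => s1 s2 s3; lra.
Unshelve. all: by end_near. Qed.

(** * The Lambert series compared with its integral *)

(* Equal to [0] at [n = 0], where the denominator vanishes. *)
Definition lambert_term (R : realType) (q : R) (n : nat) : R :=
  q ^+ n / (1 - q ^+ n).

Definition lambert_psum (R : realType) (q : R) (n : nat) : R :=
  \sum_(0 <= k < n.+1) lambert_term q k.

(* The integral of [q^t / (1 - q^t)] over [1, n]. *)
Definition lambert_int (R : realType) (q : R) (n : nat) : R :=
  (ln (1 - q ^+ n) - ln (1 - q)) / - ln q.

Definition lambert_gap (R : realType) (q : R) (n : nat) : R :=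
  lambert_psum q n - lambert_int q n.

Section lambert.
Variables (R : realType) (q : R).
Hypotheses (q0 : 0 < q) (q1 : q < 1).

Let w n : R := n%:R * lambert_term q n.

Lemma lnNq_gt0 : 0 < - ln q.
Proof. by rewrite oppr_gt0 ln_lt0 // q0. Qed.

Lemma expq_gt0 n : 0 < q ^+ n.
Proof. exact: exprn_gt0. Qed.

Lemma onemX_gt0 n : 0 < 1 - q ^+ n.+1.
Proof. by rewrite subr_gt0 exprn_ilt1 // ltW. Qed.

Lemma lambert_term_ge0 n : 0 <= lambert_term q n.
Proof.
by rewrite /lambert_term divr_ge0 ?subr_ge0 ?exprn_ile1 ?exprn_ge0 // ltW.
Qed.

Lemma lambert_psum1 : lambert_psum q 1 = q / (1 - q).
Proof.
rewrite /lambert_psum big_nat_recr //= big_nat1 /lambert_term expr0 subrr.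
by rewrite invr0 mulr0 add0r expr1.
Qed.

Lemma lambert_psumS n :
  lambert_psum q n.+1 = lambert_psum q n + lambert_term q n.+1.
Proof. by rewrite /lambert_psum big_nat_recr. Qed.

Lemma lambert_int1 : lambert_int q 1 = 0.
Proof. by rewrite /lambert_int expr1 subrr mul0r. Qed.

Lemma lambert_intB m n : lambert_int q m - lambert_int q n =
  (ln (1 - q ^+ m) - ln (1 - q ^+ n)) / - ln q.
Proof. by rewrite /lambert_int -mulrBl opprB addrA subrK. Qed.

Lemma lambert_gap1 : lambert_gap q 1 = q / (1 - q).
Proof. by rewrite /lambert_gap lambert_psum1 lambert_int1 subr0. Qed.

(** Divided by [1 - q], this compares n q^n with q + ... + q^n, whose n terms are all at least
    q^n. *)
Lemma natX_le n : n%:R * q ^+ n * (1 - q) <= q * (1 - q ^+ n).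
Proof.
elim: n => [|n IH]; first by rewrite expr0 subrr mulr0 !mul0r.
have : q * (n%:R * q ^+ n * (1 - q)) <= q * (q * (1 - q ^+ n)).
  by rewrite ler_pM2l.
have : 0 <= (1 - q ^+ n) * (1 - q) * q.
  by rewrite !mulr_ge0 ?subr_ge0 ?exprn_ile1 // ltW.
rewrite exprS -natr1; move: (q ^+ n) => Q; nra.
Qed.

Lemma lambert_weight_le n : w n <= q / (1 - q).
Proof.
case: n => [|n]; first by rewrite /w mul0r divr_ge0 ?subr_ge0 // ltW.
rewrite /w /lambert_term mulrA ler_pdivrMr ?onemX_gt0 //.
rewrite mulrAC ler_pdivlMr ?subr_gt0 //; exact: natX_le.
Qed.

Lemma lambert_weight2_lt : w 2 < q / (1 - q).
Proof.
have qq : 0 < 1 - q by rewrite subr_gt0.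
rewrite /w /lambert_term mulrA ltr_pdivrMr ?onemX_gt0 //.
rewrite mulrAC ltr_pdivlMr // expr2.
have : 0 < q * (1 - q) * (1 - q) by rewrite !mulr_gt0.
nra.
Qed.

(** With N = [n.+1], ln y <= y - 1 at y = (1 - q^N) / (1 - q^(N+1)) bounds the difference of
    logarithms; strictness comes from q (- ln q) < 1 - q. *)
Lemma lambert_int_step_gt n :
  lambert_term q n.+2 < lambert_int q n.+2 - lambert_int q n.+1.
Proof.
have x0 := lnNq_gt0.
have d1 := onemX_gt0 n; have d2 := onemX_gt0 n.+1.
rewrite lambert_intB /lambert_term.
rewrite ltr_pdivlMr //.
have h : ln (1 - q ^+ n.+1) - ln (1 - q ^+ n.+2) <=
    - (q ^+ n.+1 * (1 - q) / (1 - q ^+ n.+2)).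
  rewrite -ln_div ?posrE //.
  apply: le_trans (ln_leB1 _) _; first by rewrite divr_gt0.
  rewrite le_eqVlt; apply/orP; left; apply/eqP.
  by rewrite (exprS q n.+1); field; rewrite -exprS gt_eqF.
have k : q * - ln q < 1 - q.
  have := @ln_ltB1 R q^-1; rewrite invr_gt0 q0 lnV ?posrE //.
  have -> : q^-1 != 1 by rewrite invr_eq1 lt_eqF.
  move=> /(_ isT isT); rewrite -(ltr_pM2l q0) mulrBr divff ?mulr1 //.
  by rewrite gt_eqF.
have : q ^+ n.+1 / (1 - q ^+ n.+2) * (q * - ln q) <
  q ^+ n.+1 / (1 - q ^+ n.+2) * (1 - q).
  by rewrite ltr_pM2l // divr_gt0 ?expq_gt0.
move: h; set A := (_ / _ : R); set B := (q ^+ n.+1 / _).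
have -> : A = B * (1 - q) by rewrite /A /B mulrAC.
have -> : q ^+ n.+2 / (1 - q ^+ n.+2) * - ln q = B * (q * - ln q).
  by rewrite /B {1}(exprS q n.+1); ring.
lra.
Qed.

Lemma lambert_gap_decr n : lambert_gap q n.+2 < lambert_gap q n.+1.
Proof.
by rewrite /lambert_gap lambert_psumS; have := lambert_int_step_gt n; lra.
Qed.

Lemma bernoulli_gf_lambert n :
  bernoulli_gf (n.+1%:R * - ln q) = w n.+1 * - ln q.
Proof.
have d := onemX_gt0 n; have e := expq_gt0 n.+1.
rewrite /bernoulli_gf mulrN expRN mulrC [_ * ln q]mulrC expRM_natr
  lnK ?posrE //.
rewrite /w /lambert_term; field.
by rewrite !gt_eqF.
Qed.

(** The chord bound [ln1BexpRN_diff_le] at a = N x, b = (N+1) x, where N = [n.+1] and x = - ln q.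
    The two coefficients are the integrals of (N+1-t)/t and (t-N)/t over [N, N+1]. *)
Lemma lambert_int_step_le n :
  lambert_int q n.+2 - lambert_int q n.+1 <=
  w n.+1 * (n.+2%:R * ln_step R n - 1) + w n.+2 * (1 - n.+1%:R * ln_step R n).
Proof.
have x0 := lnNq_gt0.
have n0 : 0 < n.+1%:R :> R by [].
have n0' : 0 < n.+2%:R :> R by [].
have a0 : 0 < n.+1%:R * - ln q by rewrite mulr_gt0.
have ab : n.+1%:R * - ln q < n.+2%:R * - ln q by rewrite ltr_pM2r // ltr_nat.
have := ln1BexpRN_diff_le a0 ab; rewrite !bernoulli_gf_lambert.
have E m : expR (- (m%:R * - ln q)) = q ^+ m.
  by rewrite mulrN opprK expRM_natl lnK ?posrE.
rewrite !E !lnM ?posrE // lambert_intB.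
rewrite ler_pdivrMr // => /le_trans; apply.
rewrite le_eqVlt; apply/orP; left; apply/eqP.
have -> : ln n.+2%:R = ln n.+1%:R + ln_step R n by rewrite /ln_step addrC subrK.
rewrite -[n.+2%:R]natr1.
have -> : (n.+1%:R + 1) * - ln q - n.+1%:R * - ln q = - ln q by ring.
move: (- ln q) x0 (ln_step R n) (ln n.+1%:R) => x x0 s l.
by field; rewrite gt_eqF.
Qed.

(** Positive since [w 2 < w 1], and independent of the summation length, so it survives the passage
    to the limit and keeps the lower bound strict. *)
Let excess : R := (w 1 - w 2) * (trapezoidal_gamma R 0 - trapezoidal_gamma R 1).

(* Summation by parts: the increments of the left-hand side dominate
   [w n * (u n - u n.-1)] for the decreasing sequence [u] of trapezoidal
   approximations of Euler's constant, and [w n <= w 1]. *)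
Lemma lambert_psum_ge n :
  q / (1 - q) * trapezoidal_gamma R n.+1 + excess <=
  lambert_psum q n.+2 - lambert_int q n.+3
    + w n.+3 * (1 - n.+2%:R * ln_step R n.+1).
Proof.
have w1 : w 1 = q / (1 - q) by rewrite /w mul1r /lambert_term expr1.
have hw m : w m.+1 = lambert_term q m.+1 * m.+1%:R by rewrite mulrC.
have step m : w m.+2 * (trapezoidal_gamma R m.+1 - trapezoidal_gamma R m) <=
    lambert_psum q m.+2 - lambert_int q m.+3
    + w m.+3 * (1 - m.+2%:R * ln_step R m.+1) -
    (lambert_psum q m.+1 - lambert_int q m.+2
    + w m.+2 * (1 - m.+1%:R * ln_step R m)).
  have := lambert_int_step_le m.+1; rewrite lambert_psumS trapezoidal_gammaS.
  have -> : lambert_term q m.+2 = w m.+2 * m.+2%:R^-1.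
    by rewrite hw mulfK // pnatr_eq0.
  move: m.+2%:R^-1 => i; lra.
elim: n => [|n IH].
  (* Writing u for [trapezoidal_gamma R], the first two intervals yield w_1 u_0 + w_2 (u_1 - u_0),
     which is w_1 u_1 + [excess]. *)
  have := step 0; have := lambert_int_step_le 0.
  rewrite lambert_int1 lambert_psum1 -w1 /excess.
  have -> : trapezoidal_gamma R 0 = 2 - 2 * ln_step R 0.
    rewrite /trapezoidal_gamma series_harmonicS seriesEnat /= big_geq //.
    by rewrite /ln_step ln1 add0r invr1 mul1r subr0; ring.
  move: (trapezoidal_gamma R 1) => u; lra.
have := step n.+1.
have : q / (1 - q) * (trapezoidal_gamma R n.+2 - trapezoidal_gamma R n.+1) <=
  w n.+3 * (trapezoidal_gamma R n.+2 - trapezoidal_gamma R n.+1).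
  rewrite ler_wnM2r ?lambert_weight_le //.
  by rewrite subr_le0 ltW // trapezoidal_gamma_decr.
lra.
Qed.

(** The extra term [lambert_term q n.+3] absorbs the boundary term of [lambert_psum_ge]: for N =
    [n.+2] and s = [ln_step R n.+1], (N+1) s >= 1 gives (N+1) (1 - N s) <= 1. *)
Lemma lambert_gap_ge n :
  q / (1 - q) * trapezoidal_gamma R n.+1 + excess <= lambert_gap q n.+3.
Proof.
apply: le_trans (lambert_psum_ge n) _.
rewrite /lambert_gap (lambert_psumS n.+2).
suff : w n.+3 * (1 - n.+2%:R * ln_step R n.+1) <= lambert_term q n.+3.
  by move=> h; rewrite [leRHS]addrAC lerD2l.
rewrite /w mulrAC mulrC -[leRHS]mulr1 ler_wpM2l ?lambert_term_ge0 //.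
have : n.+2%:R * (n.+3%:R * n.+3%:R^-1) <= n.+2%:R * (n.+3%:R * ln_step R n.+1).
  by rewrite !ler_wpM2l // ln_step_ge.
by rewrite divff ?pnatr_eq0 // -[n.+3%:R]natr1; lra.
Qed.

Lemma cvg_lambert_int : lambert_int q @ \oo --> ln (1 - q) / ln q.
Proof.
have c1 : (fun n => 1 - q ^+ n) @ \oo --> (1 : R).
  rewrite -[X in _ --> X]subr0; apply: cvgB; first exact: cvg_cst.
  by apply: cvg_expr; rewrite ger0_norm // ltW.
have c2 : (fun n => ln (1 - q ^+ n)) @ \oo --> ln (1 : R).
  by apply: continuous_cvg c1; exact: continuous_ln.
have -> : ln (1 - q) / ln q = (ln 1 - ln (1 - q)) / - ln q.
  by rewrite ln1 sub0r invrN mulrNN.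
by apply: cvgMr_tmp; apply: cvgB c2 _; exact: cvg_cst.
Qed.

Lemma lambert_gap_le n : lambert_gap q n.+1 <= q / (1 - q).
Proof.
elim: n => [|n]; first by rewrite lambert_gap1.
by apply: le_trans; rewrite ltW // lambert_gap_decr.
Qed.

Lemma lambert_int_le n : lambert_int q n.+1 <= ln (1 - q) / ln q.
Proof.
rewrite /lambert_int -[leRHS]mulrNN -invrN ler_pM2r ?invr_gt0 ?lnNq_gt0 //.
have : ln (1 - q ^+ n.+1) <= 0.
  by rewrite ln_le0 // lerBlDr lerDl exprn_ge0 // ltW.
lra.
Qed.

Lemma cvgn_lambert_psum : cvgn (lambert_psum q).
Proof.
apply: nondecreasing_is_cvgn.
  apply/nondecreasing_seqP => n.
  by rewrite lambert_psumS lerDl lambert_term_ge0.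
exists (q / (1 - q) + ln (1 - q) / ln q) => _ [n _ <-].
have := lambert_gap_le n; have := lambert_int_le n; rewrite /lambert_gap.
have : lambert_psum q n <= lambert_psum q n.+1.
  by rewrite lambert_psumS lerDl lambert_term_ge0.
lra.
Qed.

Lemma cvg_lambert_gap :
  lambert_gap q @ \oo --> limn (lambert_psum q) - ln (1 - q) / ln q.
Proof. exact: cvgB cvgn_lambert_psum cvg_lambert_int. Qed.

Lemma limn_lambert_gap_le n :
  limn (lambert_psum q) - ln (1 - q) / ln q <= lambert_gap q n.+1.
Proof.
have := cvg_lambert_gap; rewrite -(cvg_shiftS (lambert_gap q)) => c.
rewrite -(cvg_lim _ c) //.
apply: (@nonincreasing_cvgn_ge _ (fun n => lambert_gap q n.+1)).
  by apply/nonincreasing_seqP => m; rewrite ltW // lambert_gap_decr.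
by apply: cvgP c.
Qed.

Lemma limn_lambert_psum_ge : q / (1 - q) <= limn (lambert_psum q).
Proof.
rewrite -lambert_psum1; apply: nondecreasing_cvgn_le cvgn_lambert_psum 1%N.
by apply/nondecreasing_seqP => n; rewrite lambert_psumS lerDl lambert_term_ge0.
Qed.

Lemma limn_lambert_gap_lt :
  limn (lambert_psum q) - ln (1 - q) / ln q < q / (1 - q).
Proof.
(* Comparing the limit with the gap at index 2, not 1, leaves one strict decrease to spare. *)
apply: le_lt_trans (limn_lambert_gap_le 1) _.
by rewrite -lambert_gap1 lambert_gap_decr.
Qed.

Lemma limn_lambert_gap_gt : q / (1 - q) * euler_gamma R <
  limn (lambert_psum q) - ln (1 - q) / ln q.
Proof.
have ex0 : 0 < excess.
  have w1 : w 1 = q / (1 - q) by rewrite /w mul1r /lambert_term expr1.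
  by rewrite /excess mulr_gt0 ?subr_gt0 ?trapezoidal_gamma_decr // w1
    lambert_weight2_lt.
suff : q / (1 - q) * euler_gamma R + excess <=
    limn (lambert_psum q) - ln (1 - q) / ln q by lra.
have c1 : (fun n => q / (1 - q) * trapezoidal_gamma R n.+1 + excess) @ \oo -->
    q / (1 - q) * euler_gamma R + excess.
  apply: cvgD; last exact: cvg_cst.
  apply: cvgMl_tmp; rewrite (cvg_shiftS (trapezoidal_gamma R)).
  exact: cvg_trapezoidal_gamma.
have c2 : (fun n => lambert_gap q n.+3) @ \oo -->
    limn (lambert_psum q) - ln (1 - q) / ln q.
  have := cvg_lambert_gap; rewrite -(cvg_shiftn 3).
  by under eq_fun do rewrite addn3.
by apply: ler_cvg_to c1 c2 _; near=> n; exact: lambert_gap_ge.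
Unshelve. all: by end_near. Qed.

Lemma limn_lambert_gap_le_harmonic n :
  (1 - q) / q * (limn (lambert_psum q) - ln (1 - q) / ln q) <=
  series harmonic n.+1 - ln n.+1%:R + n.+1%:R * - ln q.
Proof.
have x0 := lnNq_gt0.
have qq : 0 < 1 - q by rewrite subr_gt0.
have k : - ln q <= (1 - q) / q.
  have := @ln_leB1 R q^-1; rewrite invr_gt0 q0 lnV ?posrE // => /(_ isT).
  by rewrite mulrBl mul1r divff ?gt_eqF.
(* Term by term, since m f(m) <= f(1) = q / (1 - q). *)
have psum_le m : (1 - q) / q * lambert_psum q m <= series harmonic m.
  elim: m => [|m IH].
    by rewrite /lambert_psum big_nat1 /lambert_term subrr invr0 !mulr0
      seriesEnat /= big_geq.
  rewrite lambert_psumS series_harmonicS mulrDr lerD //.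
  have h : (1 - q) / q * w m.+1 <= (1 - q) / q * (q / (1 - q)).
    by rewrite ler_pM2l ?lambert_weight_le ?divr_gt0.
  have e : (1 - q) / q * (q / (1 - q)) = 1 by field; rewrite !gt_eqF.
  by move: h; rewrite e /w => h; rewrite -[leRHS]mulr1 ler_pdivlMl // mulrCA.
(* The factor (1 - q) / (q (- ln q)) is at least 1 by [k], and (1 - q^N) / (1 - q) >= N q^N by
   [natX_le], with N = [n.+1]. *)
have int_ge : ln n.+1%:R - n.+1%:R * - ln q <= (1 - q) / q * lambert_int q n.+1.
  rewrite /lambert_int.
  apply: (@le_trans _ _ (ln (1 - q ^+ n.+1) - ln (1 - q))).
    rewrite mulrN opprK mulr_natl -lnXn // -lnM ?posrE ?exprn_gt0 //.
    rewrite -ln_div ?posrE ?onemX_gt0 //.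
    rewrite ler_ln ?posrE ?divr_gt0 ?onemX_gt0 ?mulr_gt0 ?exprn_gt0 //.
    rewrite ler_pdivlMr //; apply: le_trans (natX_le n.+1) _.
    by rewrite ler_piMl // ltW // onemX_gt0.
  rewrite mulrCA -[leLHS]mulr1 ler_wpM2l //.
    rewrite subr_ge0 ler_ln ?posrE ?onemX_gt0 //.
    by rewrite lerD2l lerN2 exprS ler_piMr ?exprn_ile1 // ltW.
  by rewrite ler_pdivlMr // mul1r.
have := limn_lambert_gap_le n.
rewrite -(ler_pM2l (divr_gt0 qq q0)) => /le_trans.
apply; rewrite /lambert_gap mulrBr.
have := psum_le n.+1; lra.
Qed.

End lambert.

(** * From the Lambert series to divisor sums *)

Lemma cvg_natX (R : realType) (q : R) : 0 < q -> q < 1 ->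
  (fun n => n%:R * q ^+ n) @ \oo --> (0 : R).
Proof.
(* Splitting q^n as s^n s^n, [natX_le] bounds n s^n and the other factor tends to 0. *)
move=> q0 q1; pose s := Num.sqrt q.
have s0 : 0 < s by rewrite sqrtr_gt0.
have s1 : s < 1 by rewrite -sqrtr1 ltr_sqrt.
have sE : q = s * s by rewrite -expr2 sqr_sqrtr // ltW.
have c : (fun n => s / (1 - s) * s ^+ n) @ \oo --> (0 : R).
  rewrite -[X in _ --> X](mulr0 (s / (1 - s))); apply: cvgMl_tmp.
  by apply: cvg_expr; rewrite ger0_norm // ltW.
apply: (squeeze_cvgr _ (@cvg_cst _ 0 _ _ _) c); near=> n => /=.
rewrite mulr_ge0 ?exprn_ge0 ?(ltW q0) //= sE exprMn mulrA.
rewrite ler_wpM2r ?exprn_ge0 ?(ltW s0) // ler_pdivlMr ?subr_gt0 //.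
apply: le_trans (natX_le s0 s1 n) _.
by rewrite ler_piMr ?(ltW s0) // gerBl exprn_ge0 // ltW.
Unshelve. all: by end_near. Qed.

(** The range depends only on a common bound [n] for all [k], as the exchange of summations
    requires. *)
Lemma num_divisorsE (n k : nat) : (0 < k <= n)%N ->
  num_divisors k = (\sum_(1 <= a < n.+1 | a %| k) 1)%N.
Proof.
move=> /andP[k0 kn]; rewrite sum1_count /num_divisors -size_filter.
apply/perm_size/uniq_perm; rewrite ?divisors_uniq ?filter_uniq ?iota_uniq //.
move=> a; rewrite -dvdn_divisors // mem_filter mem_index_iota.
case: (boolP (a %| k)%N) => //= ak.
by rewrite (dvdn_gt0 k0 ak) ltnS (leq_trans (dvdn_leq k0 ak) kn).
Qed.

Definition divisor_gf_psum (R : realType) (q : R) (n : nat) : R :=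
  \sum_(1 <= k < n.+1) (num_divisors k)%:R * q ^+ k.

Lemma divisor_gf_psum_exchange (R : realType) (q : R) n :
  divisor_gf_psum q n =
  \sum_(1 <= a < n.+1) \sum_(1 <= k < n.+1 | (a %| k)%N) q ^+ k.
Proof.
rewrite /divisor_gf_psum.
under [RHS]eq_bigr do rewrite big_mkcond.
rewrite exchange_big /=; apply: eq_big_nat => k; rewrite ltnS => kn.
rewrite (num_divisorsE kn) natr_sum mulr_suml big_mkcond /=.
by apply: eq_bigr => a _; case: ifP; rewrite ?mul1r.
Qed.

Section divisor_gf.
Variables (R : realType) (q : R).
Hypotheses (q0 : 0 < q) (q1 : q < 1).

Lemma multiples_sum a n : \sum_(1 <= k < n.+1 | (a.+1 %| k)%N) q ^+ k =
  lambert_term q a.+1 * (1 - q ^+ (a.+1 * (n %/ a.+1))).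
Proof.
have d := onemX_gt0 q0 q1 a.
elim: n => [|n IH]; first by rewrite big_geq // div0n muln0 expr0 subrr mulr0.
rewrite big_mkcond big_nat_recr //= -big_mkcond IH divnS //.
case: (boolP (a.+1 %| n.+1)%N) => [dv|_]; last by rewrite add0n addr0.
have -> : q ^+ n.+1 = q ^+ a.+1 * q ^+ (a.+1 * (n %/ a.+1)).
  rewrite -exprD -mulnS mulnC; congr (_ ^+ _).
  by rewrite -{1}(divnK dv) divnS // dv add1n.
rewrite add1n mulnS exprD /lambert_term.
by field; rewrite gt_eqF.
Qed.

(** Each [a] misses the multiples of [a] beyond [n], a geometric tail starting at exponent a (n %/ a
    + 1) > n; so each of the [n] tails is at most q^n / (1 - q). *)
Lemma lambert_psumB_divisor_gf_psum n :
  0 <= lambert_psum q n - divisor_gf_psum q n <= (n%:R * q ^+ n) / (1 - q).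
Proof.
have -> : lambert_psum q n - divisor_gf_psum q n =
    \sum_(1 <= a < n.+1) lambert_term q a * q ^+ (a * (n %/ a)).
  rewrite divisor_gf_psum_exchange /lambert_psum big_ltn //.
  rewrite {1}/lambert_term expr0 subrr invr0 mulr0 add0r -sumrB.
  apply: eq_big_nat => -[|a] // _; rewrite multiples_sum; ring.
have -> : n%:R * q ^+ n / (1 - q) = \sum_(1 <= a < n.+1) q ^+ n / (1 - q).
  by rewrite sumr_const_nat subn1 /= -mulrA mulr_natl.
apply/andP; split.
  by apply: sumr_ge0 => a _;
    rewrite mulr_ge0 ?lambert_term_ge0 ?exprn_ge0 // ltW.
rewrite big_nat [leRHS]big_nat; apply: ler_sum => -[|a] // _.
rewrite /lambert_term mulrAC -exprD -mulnS.
apply: ler_pM; rewrite ?exprn_ge0 ?invr_ge0 ?subr_ge0 ?exprn_ile1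
  ?(ltW q0) ?(ltW q1) //.
  by rewrite ler_wiXn2l ?(ltW q0) ?(ltW q1) // mulnC ltnW // ltn_ceil.
rewrite lef_pV2 ?posrE ?onemX_gt0 ?subr_gt0 //.
by rewrite lerD2l lerN2 exprS ler_piMr ?exprn_ile1 ?(ltW q0) ?(ltW q1).
Qed.

Lemma cvg_divisor_gf_psum : divisor_gf_psum q @ \oo --> limn (lambert_psum q).
Proof.
have c0 : (fun n => lambert_psum q n - divisor_gf_psum q n) @ \oo --> (0 : R).
  have c : (fun n => n%:R * q ^+ n / (1 - q)) @ \oo --> (0 : R).
    rewrite -[X in _ --> X](mul0r (1 - q)^-1); apply: cvgMr_tmp.
    exact: cvg_natX.
  apply: (squeeze_cvgr _ (@cvg_cst _ 0 _ _ _) c); near=> n.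
  exact: lambert_psumB_divisor_gf_psum.
have -> : divisor_gf_psum q =
    (fun n => lambert_psum q n - (lambert_psum q n - divisor_gf_psum q n)).
  by apply/funext => n; rewrite opprB addrC subrK.
rewrite -[X in _ --> X]subr0; exact: cvgB (cvgn_lambert_psum q0 q1) c0.
Unshelve. all: by end_near. Qed.

(** Shifting the index divides by [q] after removing the first term d(1) q = q; the shifted sum
    reaches exponent [n.+1], the other one stops at [n]. *)
Lemma divisor_diff_psumS n : divisor_diff_psum q n.+1 =
  q^-1 * (divisor_gf_psum q n.+1 - q) - divisor_gf_psum q n.
Proof.
have D1 : divisor_gf_psum q 1 = q.
  by rewrite /divisor_gf_psum big_nat1 /num_divisors mul1r expr1.
have D0 : divisor_gf_psum q 0 = 0 by rewrite /divisor_gf_psum big_geq.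
elim: n => [|n IH].
  by rewrite D1 D0 subrr mulr0 subr0 /divisor_diff_psum big_geq.
rewrite /divisor_diff_psum big_nat_recr //= -/(divisor_diff_psum q n.+1) IH.
have DS m : divisor_gf_psum q m.+1 =
    divisor_gf_psum q m + (num_divisors m.+1)%:R * q ^+ m.+1.
  by rewrite /divisor_gf_psum big_nat_recr.
rewrite (DS n.+1) (DS n) (exprS q n.+1).
by field; rewrite gt_eqF.
Qed.

Lemma cvg_divisor_diff_psum : divisor_diff_psum q @ \oo -->
  (1 - q) / q * limn (lambert_psum q) - 1.
Proof.
have c := cvg_divisor_gf_psum; rewrite -(cvg_shiftS (divisor_diff_psum q)).
have -> : (1 - q) / q * limn (lambert_psum q) - 1 =
  q^-1 * (limn (lambert_psum q) - q) - limn (lambert_psum q).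
  by field; rewrite gt_eqF.
under eq_fun do rewrite divisor_diff_psumS.
apply: (cvgB _ c); apply: cvgMl_tmp; apply: cvgB; last exact: cvg_cst.
by rewrite (cvg_shiftS (divisor_gf_psum q)).
Qed.

(** [log_quotient q] is (1 - q) / q times the limit of [lambert_int q], so the remaining bracket is
    the limit of [lambert_gap q]. *)
Lemma divisor_diff_sumB_log_quotient :
  divisor_diff_sum q - log_quotient q =
  (1 - q) / q * (limn (lambert_psum q) - ln (1 - q) / ln q) - 1.
Proof.
rewrite /divisor_diff_sum (cvg_lim _ cvg_divisor_diff_psum) // /log_quotient.
have := lnNq_gt0 q0 q1; rewrite oppr_gt0 => x0.
by field; rewrite (gt_eqF q0) (lt_eqF x0).
Qed.

(** For sharpness as q tends to 0: keep only the first Lambert term and use - ln (1 - q) <= q / (1 -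
    q). *)
Lemma divisor_diff_sumB_log_quotient_ge :
  (ln q)^-1 <= divisor_diff_sum q - log_quotient q.
Proof.
rewrite divisor_diff_sumB_log_quotient.
have x0 := lnNq_gt0 q0 q1; have lq0 : ln q < 0 by rewrite -oppr_gt0.
have qq : 0 < 1 - q by rewrite subr_gt0.
have k : - ln (1 - q) <= q / (1 - q).
  have := @ln_leB1 R (1 - q)^-1; rewrite invr_gt0 qq lnV ?posrE // => /(_ isT).
  have -> // : (1 - q)^-1 - 1 = q / (1 - q) by field; rewrite gt_eqF.
have qE : (1 - q) / q * (q / (1 - q)) = 1 by field; rewrite !gt_eqF.
have L : 1 <= (1 - q) / q * limn (lambert_psum q).
  by rewrite -[leLHS]qE ler_pM2l ?divr_gt0 // limn_lambert_psum_ge.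
have M : (1 - q) / q * (ln (1 - q) / ln q) <= - (ln q)^-1.
  have -> : (1 - q) / q * (ln (1 - q) / ln q) =
      (1 - q) / q * - ln (1 - q) * (- ln q)^-1.
    by field; rewrite (gt_eqF q0) (lt_eqF lq0).
  rewrite -invrN -[leRHS]mul1r ler_wpM2r ?invr_ge0 ?(ltW x0) //.
  by rewrite -[leRHS]qE ler_pM2l ?divr_gt0.
rewrite mulrBr; lra.
Qed.

End divisor_gf.

(** * The two bounds and the sharpness of their constants *)

Theorem theorem4p2 (R : realType) :
  (forall q : R, 0 < q -> q < 1 ->
     [/\ cvgn (divisor_diff_psum q),
         euler_gamma R - 1 + log_quotient q < divisor_diff_sum q
       & divisor_diff_sum q < log_quotient q]) /\
  (forall alpha0 beta0 : R,
     (forall q : R, 0 < q -> q < 1 ->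
        alpha0 + log_quotient q < divisor_diff_sum q /\
        divisor_diff_sum q < beta0 + log_quotient q) ->
     alpha0 <= euler_gamma R - 1 /\ 0 <= beta0).
Proof.
split=> [q q0 q1|alpha0 beta0 bounds].
  have qq : 0 < (1 - q) / q by rewrite divr_gt0 // subr_gt0.
  have qE : (1 - q) / q * (q / (1 - q)) = 1.
    by field; rewrite subr_eq0 !gt_eqF.
  have E := divisor_diff_sumB_log_quotient q0 q1; split.
  - exact: cvgP (cvg_divisor_diff_psum q0 q1).
  - have := limn_lambert_gap_gt q0 q1.
    by rewrite -(ltr_pM2l qq) mulrA qE mul1r; lra.
  - have := limn_lambert_gap_lt q0 q1.
    by rewrite -(ltr_pM2l qq) qE; lra.
split.
  have c : (fun n => series harmonic n.+1 - ln n.+1%:R + harmonic n : R) @ \oo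
      --> euler_gamma R.
    rewrite -[euler_gamma R]addr0; apply: cvgD cvg_harmonic.
    by have := @cvg_euler_gamma R; rewrite -(cvg_shiftS _).
  rewrite lerBrDr; apply: (cvgr_to_ge c); near=> n.
  (* With N = [n.+1], this makes the error N (- ln q) equal to 1/N. *)
  pose q : R := expR (- n.+1%:R ^- 2).
  have q0 : 0 < q by exact: expR_gt0.
  have q1 : q < 1 by rewrite expR_lt1 oppr_lt0 invr_gt0 exprn_gt0.
  have [+ _] := bounds q q0 q1.
  have := limn_lambert_gap_le_harmonic q0 q1 n.
  have := divisor_diff_sumB_log_quotient q0 q1.
  have -> : n.+1%:R * - ln q = harmonic n.
    by rewrite /q expRK opprK /=; field; rewrite gt_eqF.
  lra.
rewrite leNgt; apply/negP => b0.
(* Then 1 / ln q = [beta0], so the lower bound on the difference contradicts the assumed strict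
   upper bound. *)
pose q := expR beta0^-1.
have q0 : 0 < q by exact: expR_gt0.
have q1 : q < 1 by rewrite expR_lt1 invr_lt0.
have [_] := bounds q q0 q1.
have := divisor_diff_sumB_log_quotient_ge q0 q1; rewrite /q expRK invrK; lra.
Unshelve. all: by end_near. Qed.
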